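(* Let $F$ be a field, and let $F(x)$ be the field of rational functions in $x$ over $F$. Let $G$ be any finite subgroup of $PGL(2,F)$. Assume that $G$ is not a subgroup of $PGL(2,K)$ for any proper subfield $K$ of $F$. Let $f(x)/g(x)$, with $f,g\in F[x]$ relatively prime and one of $f,g$ monic, be a nonconstant coefficient of the orbit polynomial $P_G(T)$ of $G$. Let $L_F$ be the splitting field of $f(T)-xg(T)$ considered as an element of $F(x)[T]$. Let $H$ be a nontrivial finite group of automorphisms of $F$, with fixed field $E$, and suppose that $H$ fixes $G$. Then $f$ and $g$ have coefficients in $E$. Furthermore, let $L_E$ be the splitting field (inside $L_F$) of $f(T)-xg(T)$ considered as an element of $E(x)[T]$. Then $F(x)\subseteq L_E$ and $L_E=L_F$.
   Context: Elements of $PGL(2,F)$ are written as linear fractional transformations $s(x)=\frac{ax+b}{cx+d}$ with $a,b,c,d\in F$, $ad-bc\neq0$. The orbit polynomial of $G$ is $P_G(T)=\prod_{s\in G}(T-s(x))\in F(x)[T]$; a coefficient is nonconstant if it is not in $F$. ''$G$ is defined over the subfield $K$ of $F$'' means: for each $s\in G$, $s(x)=(ax+b)/(cx+d)$, there is a nonzero $e\in\{a,b,c,d\}$ such that $a/e,b/e,c/e,d/e$ all lie in $K$. ''$G$ is not a subgroup of $PGL(2,K)$ for any proper subfield $K$ of $F$'' means that $G$ is not defined over any proper subfield $K$ of $F$. For $\sigma\in H$ and $s(x)=\frac{ax+b}{cx+d}$ in $PGL(2,F)$, put $\sigma.s(x)=\frac{\sigma(a)x+\sigma(b)}{\sigma(c)x+\sigma(d)}$,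 and $\sigma.G=\{\sigma.s: s\in G\}$. ''$H$ fixes $G$'' means $\sigma.G=G$ for all $\sigma\in H$. *)

(* Defs.v *)
From HB Require Import structures.
From mathcomp Require Import all_boot all_order all_algebra all_field.
From mathcomp Require Import all_classical.

Set Implicit Arguments.
Unset Strict Implicit.
Unset Printing Implicit Defensive.

Import GRing.Theory.
Local Open Scope classical_set_scope.
Local Open Scope ring_scope.

Notation "x %:F" := (FracField.tofrac x) (at level 1, format "x %:F").

Section Subfields.
Variable R : fieldType.
Implicit Types (K A : set R) (p : {poly R}).

Definition is_subfield K := divring_closed (mem K).

Definition subfield_gen A : set R := smallest is_subfield A.

(** Meaningful when [p] splits into linear factors in [R]: this is then the
    splitting field of [p] over [K] inside [R]. *)
Definition splitting_subfield K p : set R :=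
  subfield_gen (K `|` [set z | root p z]).

End Subfields.

Section RationalFunctions.
Variable F : fieldType.
Implicit Types (s t : {fraction {poly F}}) (A : 'M[F]_2).
Implicit Types (G : set {fraction {poly F}}) (K : set F).

Definition ratfun_const (a : F) : {fraction {poly F}} := a%:P%:F.

Definition ratfun_constP (p : {poly F}) : {poly {fraction {poly F}}} :=
  map_poly ratfun_const p.

(** [s(t(x))], for [t] not in [F]: such a [t] is transcendental over [F], so
    the denominator of [s] does not vanish at [t]. *)
Definition ratfun_comp s t : {fraction {poly F}} :=
  (ratfun_constP (\n_(repr s))).[t] / (ratfun_constP (\d_(repr s))).[t].

(** [(a x + b) / (c x + d)], where [A] has rows [(a, b)] and [(c, d)]. *)
Definition lft A : {fraction {poly F}} :=
  (A 0 0 *: 'X + (A 0 1)%:P)%:F / (A 1 0 *: 'X + (A 1 1)%:P)%:F.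

(** [PGL(2,F)] is realised inside [F(x)], with composition as group law. *)
Definition PGL2 : set {fraction {poly F}} := lft @` [set A | \det A != 0].

Definition is_subgroup_PGL2 G :=
  [/\ G `<=` PGL2,
      G 'X%:F,
      forall s t, G s -> G t -> G (ratfun_comp s t)
    & forall s, G s -> exists t,
        [/\ G t, ratfun_comp s t = 'X%:F & ratfun_comp t s = 'X%:F]].

Definition defined_over G K :=
  forall A, \det A != 0 -> G (lft A) ->
  exists i j, A i j != 0 /\ forall k l, K (A k l / A i j).

(** Every factor differs from [1], so for finite [G] the finitely supported
    product ranges over all of [G]. *)
Definition orbit_poly G : {poly {fraction {poly F}}} :=
  \big[*%R/1]_(s \in G) ('X - s%:P).

Definition nonconstant s := ~ exists a, s = ratfun_const a.

(** [f(T) - x g(T)] as a polynomial in [T] over [F(x)]. *)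
Definition generic_fiber (f g : {poly F}) : {poly {fraction {poly F}}} :=
  ratfun_constP f - 'X%:F *: ratfun_constP g.

(** [K(x)], as a subset of [F(x)]. *)
Definition ratfun_over K : set {fraction {poly F}} :=
  [set s | exists p q : {poly F},
    [/\ p \is a polyOver (mem K), q \is a polyOver (mem K), q != 0
      & s = p%:F / q%:F]].

(** The existence of inverses makes every element of [H] bijective. *)
Definition is_automorphism_group (H : set {rmorphism F -> F}) :=
  [/\ H idfun,
      forall sigma tau, H sigma -> H tau -> H (sigma \o tau)
    & forall sigma, H sigma -> exists tau : {rmorphism F -> F},
        [/\ H tau, cancel sigma tau & cancel tau sigma]].

Definition fixed_field (H : set {rmorphism F -> F}) : set F :=
  [set a | forall sigma, H sigma -> sigma a = a].

Definition aut_act (sigma : {rmorphism F -> F}) G : set {fraction {poly F}} :=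
  [set lft (map_mx sigma A) | A in [set A | \det A != 0 /\ G (lft A)]].

End RationalFunctions.

(* Main.v *)
Require Import Defs.
From HB Require Import structures.
From mathcomp Require Import all_boot all_order all_algebra all_field.
From mathcomp Require Import all_classical.
From mathcomp Require Import ring.

Set Implicit Arguments.
Unset Strict Implicit.
Unset Printing Implicit Defensive.

Import GRing.Theory.
Local Open Scope classical_set_scope.
Local Open Scope ring_scope.

(** Write h = f/g.  Composition with an element of G permutes G, hence fixes
    P_G(T) and its coefficient h: h(s(x)) = h(x) for s in G.  Likewise every
    sigma in H permutes G when acting on coefficients, so it fixes the reduced
    fraction f/g; as f or g is monic, it fixes f and g themselves, which
    therefore lie in E[x].

    Let y be any root of f(T) - x g(T) in L_F.  Then h(y) = x, so y is
    transcendental over F and x |-> y embeds F(x) into L_F.  By invariance of h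
    the conjugates s(y), s in G, are roots too, so they all lie in L_E.

    The heart of the proof is that L_E contains F.  Let A be a matrix of s in G,
    with entries scaled by the inverse of a nonzero entry, and let a be one of
    the scaled entries.  A linear fractional transformation determines its
    matrix up to a scalar ([lft_proportional]), so sigma(a) depends only on the
    conjugate sigma.s, and the finitely many assignments sigma.s |-> sigma(a)
    are interpolated by a polynomial Q over F(x).  By the symmetry of
    Lagrange's formula Q is H-invariant ([equivariant_interpolation]), and an
    H-invariant rational function is a quotient of polynomials over E
    ([fixed_ratfun_over]).  Thus a = Q(s(x)) with Q over E(x)
    ([normalized_entry_over_fixed_field]), and substituting y for x gives a in
    L_E.  Hence G is defined over the subfield of those elements of F that lie
    in L_E, and by the minimality of F this subfield is F.  Therefore L_E
    contains F and x, that is F(x), and all the roots, so it is L_F.  This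
    replaces the Galois correspondence for F(y) over E(y) by an explicit
    interpolation. *)

(** * Extending ring morphisms to fraction fields *)

Section FractionFieldMorphisms.
Variables (R : idomainType) (M : fieldType) (phi : {rmorphism R -> M}).

Lemma fracE (x : {fraction R}) : x = (\n_(repr x))%:F / (\d_(repr x))%:F.
Proof.
apply: (canRL (mulfK _)); first by rewrite tofrac_eq0 denom_ratioP.
rewrite -{1}[x]reprK; unlock FracField.tofrac.
rewrite -[LHS]FracField.pi_mul; apply/eqmodP => /=.
rewrite FracField.equivfE /FracField.mulf.
by rewrite !numden_Ratio ?mulf_neq0 ?oner_eq0 ?denom_ratioP // !mulr1 mulrC.
Qed.

Definition frac_lift (x : {fraction R}) : M :=
  phi \n_(repr x) / phi \d_(repr x).

Hypothesis phi_inj : injective phi.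

Lemma frac_lift_div p q : q != 0 -> frac_lift (p%:F / q%:F) = phi p / phi q.
Proof.
have phi0 r : (phi r == 0) = (r == 0) by rewrite -(inj_eq phi_inj) rmorph0.
move=> q0; rewrite /frac_lift; set x := _ / _.
apply/eqP; rewrite eqr_div ?phi0 ?denom_ratioP // -!rmorphM (inj_eq phi_inj).
by rewrite -tofrac_eq !tofracM -eqr_div ?tofrac_eq0 ?denom_ratioP // -fracE.
Qed.

Lemma frac_lift_tofrac p : frac_lift p%:F = phi p.
Proof.
by rewrite -[p%:F]divr1 -tofrac1 frac_lift_div ?oner_eq0 // rmorph1 divr1.
Qed.

Lemma frac_lift_zmod_morphism : zmod_morphism frac_lift.
Proof.
have phi0 r : r != 0 -> phi r != 0 by rewrite -(inj_eq phi_inj) rmorph0.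
move=> x y; rewrite [x in LHS]fracE [y in LHS]fracE.
have [dx0 dy0] := (denom_ratioP (repr x), denom_ratioP (repr y)).
rewrite -mulNr -tofracN addf_div ?tofrac_eq0 // -!tofracM -tofracD.
rewrite frac_lift_div ?mulf_neq0 // rmorphD !rmorphM rmorphN.
by rewrite -addf_div ?phi0 // mulNr.
Qed.

Lemma frac_lift_monoid_morphism : monoid_morphism frac_lift.
Proof.
split=> [|x y]; first by rewrite -tofrac1 frac_lift_tofrac rmorph1.
rewrite [x in LHS]fracE [y in LHS]fracE mulf_div -!tofracM.
by rewrite frac_lift_div ?mulf_neq0 ?denom_ratioP // !rmorphM -mulf_div.
Qed.

End FractionFieldMorphisms.

(** * Subfields as sets *)

Lemma polyOver_setP (R : fieldType) (K : set R) (p : {poly R}) :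
  K 0 -> (p \is a polyOver (mem K)) <-> (forall i, K p`_i).
Proof.
move=> K0; split=> [/allP pK i|pK].
  have [lt_i|?] := ltnP i (size p); last by rewrite nth_default.
  by have := pK _ (mem_nth 0 lt_i); rewrite inE.
by apply/(all_nthP 0) => i _; rewrite inE.
Qed.

Section SubfieldClosure.
Variables (R : fieldType) (S : set R).
Hypothesis S_subfield : is_subfield S.

Lemma subfield1 : S 1.
Proof. by case: S_subfield => + _ _; rewrite inE. Qed.

Lemma subfieldB x y : S x -> S y -> S (x - y).
Proof.
case: S_subfield => _ + _ Sx Sy => /(_ x y).
by rewrite !inE => /(_ Sx Sy).
Qed.

Lemma subfield_div x y : S x -> S y -> S (x / y).
Proof.
case: S_subfield => _ _ + Sx Sy => /(_ x y).
by rewrite !inE => /(_ Sx Sy).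
Qed.

Lemma subfield0 : S 0.
Proof. by rewrite -(subrr 1); apply: subfieldB; exact: subfield1. Qed.

Lemma subfieldD x y : S x -> S y -> S (x + y).
Proof.
move=> Sx Sy; rewrite -[y]opprK -[- y]sub0r.
by apply: subfieldB => //; apply: subfieldB => //; exact: subfield0.
Qed.

Lemma subfieldM x y : S x -> S y -> S (x * y).
Proof.
move=> Sx Sy; rewrite -[y]invrK -[y^-1]div1r.
by apply: subfield_div => //; apply: subfield_div => //; exact: subfield1.
Qed.

Lemma subfield_horner (p : {poly R}) x : (forall i, S p`_i) -> S x -> S p.[x].
Proof.
move=> Sp Sx; rewrite horner_coef.
elim/big_ind: _ => [||i _]; [exact: subfield0|exact: subfieldD|].
apply: subfieldM => //; elim: (nat_of_ord i) => [|k IHk].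
  by rewrite expr0; exact: subfield1.
by rewrite exprS; exact: subfieldM.
Qed.

End SubfieldClosure.

Lemma subfield_genP (R : fieldType) (A : set R) : is_subfield (subfield_gen A).
Proof.
split=> [|x y|x y]; rewrite !inE.
- by move=> S [S_sub _]; exact: subfield1.
- by move=> Ax Ay S [S_sub AS]; apply: subfieldB; [|apply: Ax|apply: Ay].
- by move=> Ax Ay S [S_sub AS]; apply: subfield_div; [|apply: Ax|apply: Ay].
Qed.

Lemma subfield_preim (K L : fieldType) (iota : {rmorphism K -> L}) (S : set L) :
  is_subfield S -> is_subfield (iota @^-1` S).
Proof.
move=> S_sub; split=> [|x y|x y]; rewrite !inE /=.
- by rewrite rmorph1; exact: subfield1.
- by rewrite rmorphB; exact: subfieldB.
- by rewrite fmorph_div; exact: subfield_div.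
Qed.

(** The extension generated by finitely many elements is contained in every set
    that is closed under the field operations and contains the base field and
    the generators, since it consists of iterated polynomial expressions. *)
Lemma subfield_adjoin (K : fieldType) (L : fieldExtType K) (rs : seq L)
    (S : set L) :
  is_subfield S -> range (in_alg L) `<=` S -> [set` rs] `<=` S ->
  forall z, z \in <<1 & rs>>%VS -> S z.
Proof.
move=> S_sub KS; elim/last_ind: rs => [|rs r IHrs] rsS z.
  by rewrite adjoin_nil subfield_closed => /vlineP[k ->]; apply: KS; exists k.
have {}IHrs : forall z, z \in <<1 & rs>>%VS -> S z.
  by apply: IHrs => y /= y_rs; apply: rsS; rewrite /= mem_rcons inE y_rs orbT.
rewrite adjoin_rcons => /Fadjoin_polyP[p /polyOverP p_rs ->].
apply: subfield_horner => // [i|]; first exact/IHrs/p_rs.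
by apply: rsS; rewrite /= mem_rcons mem_head.
Qed.

(** * Evaluating rational functions at transcendental elements *)

HB.instance Definition _ (F : fieldType) :=
  GRing.RMorphism.copy (@ratfun_const F) (@FracField.tofrac _ \o polyC).

Section Transcendental.
Variables (F M : fieldType) (iota : {rmorphism F -> M}).

(** The elements algebraic over [F] form a field, so an element some rational
    expression of which is transcendental is itself transcendental. *)
Lemma transcendental_ratio (p q : {poly F}) y :
  ~ algebraicOver iota ((map_poly iota p).[y] / (map_poly iota q).[y]) ->
  ~ algebraicOver iota y.
Proof.
have alg_horner r : algebraicOver iota y ->
    algebraicOver iota (map_poly iota r).[y].
  rewrite !integral_algebraic; apply: integral_horner.
  by apply/integral_poly => i; rewrite coef_map; exact: integral_id.
by move=> trans y_alg; apply: trans; apply: algebraic_div; exact: alg_horner.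
Qed.

(** With [iota := @ratfun_const F] this is, definitionally, [ratfun_comp]. *)
Definition ratfun_eval (y : M) : {fraction {poly F}} -> M :=
  frac_lift (horner_eval y \o map_poly iota).

(** Transcendence of [y] is exactly injectivity of the evaluation of polynomials
    at [y], which is what extending it to fractions requires. *)
Lemma ratfun_eval_rmorphism y : ~ algebraicOver iota y ->
  exists2 psi : {rmorphism {fraction {poly F}} -> M},
    psi =1 ratfun_eval y & forall p, psi p%:F = (map_poly iota p).[y].
Proof.
move=> y_trans; have inj : injective (horner_eval y \o map_poly iota).
  apply: raddf_inj => p /= /eqP py0; apply/eqP/negPn/negP => p0.
  by apply: y_trans; exists p.
pose psiZ := GRing.isZmodMorphism.Build _ _ _ (frac_lift_zmod_morphism inj).
pose psiM := GRing.isMonoidMorphism.Build _ _ _ (frac_lift_monoid_morphism inj).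
pose psi : {rmorphism _ -> _} := HB.pack (ratfun_eval y) psiZ psiM.
by exists psi => // p; exact: (frac_lift_tofrac inj).
Qed.

End Transcendental.

Lemma perm_map_stable (T : eqType) (h : T -> T) (r : seq T) :
  injective h -> uniq r -> {in r, forall x, h x \in r} ->
  perm_eq (map h r) r.
Proof.
move=> h_inj r_uniq r_stable; apply: uniq_perm => //.
  by rewrite map_inj_uniq.
apply: (uniq_min_size _ _ _).2; rewrite ?map_inj_uniq ?size_map //.
by move=> _ /mapP[x /r_stable ? ->].
Qed.

Section RationalFunctionField.
Variable F : fieldType.
Implicit Types (p q : {poly F}) (s t : {fraction {poly F}}) (A B : 'M[F]_2).

Lemma ratfun_constP_X p : (ratfun_constP p).['X%:F] = p%:F.
Proof.
rewrite /ratfun_constP (map_poly_comp (@FracField.tofrac _) polyC) horner_map.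
by rewrite /= -[_.['X]]/(p \Po 'X) comp_polyXr.
Qed.

Lemma ratfun_X_transcendental : ~ algebraicOver (@ratfun_const F) 'X%:F.
Proof.
case=> p p0; rewrite /root -/(ratfun_constP p) ratfun_constP_X tofrac_eq0.
exact/negP.
Qed.

(** The inverse [t] of [s] in the group gives [t(s(x)) = x], which is
    transcendental. *)
Lemma subgroup_PGL2_transcendental (G : set {fraction {poly F}}) s :
  is_subgroup_PGL2 G -> G s -> ~ algebraicOver (@ratfun_const F) s.
Proof.
move=> [_ _ _ G_inv] /G_inv[t [_ _ tsX]].
apply: (@transcendental_ratio _ _ _ \n_(repr t) \d_(repr t)).
by rewrite -/(ratfun_comp t s) tsX; exact: ratfun_X_transcendental.
Qed.

(** * Invariance of the orbit polynomial *)

(** A field endomorphism mapping the finite set [G] into itself permutes it, as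
    it is injective, and so permutes the factors.  This applies both to the
    composition with an element of [G] and to the action on coefficients of a
    field automorphism that fixes [G]. *)
Lemma orbit_poly_fixed (G : set {fraction {poly F}})
    (psi : {rmorphism {fraction {poly F}} -> {fraction {poly F}}}) :
  finite_set G -> (forall s, G s -> G (psi s)) ->
  map_poly psi (orbit_poly G) = orbit_poly G.
Proof.
move=> /finite_seqP[r0 ->]; pose r := undup r0.
have -> : [set` r0] = [set` r].
  by apply/seteqP; split=> s /=; rewrite mem_undup.
move=> r_stable; have r_uniq : uniq r by exact: undup_uniq.
rewrite /orbit_poly -fsbig_seq // rmorph_prod.
under eq_bigr do rewrite rmorphB /= map_polyX map_polyC.
transitivity (\prod_(s <- map psi r) ('X - s%:P)); first by rewrite big_map.
by apply/perm_big/perm_map_stable => //; exact: fmorph_inj.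
Qed.

(** The map [t |-> t(s(x))] is a field endomorphism stabilising [G]. *)
Lemma orbit_coef_invariant (G : set {fraction {poly F}}) n p q s :
  is_subgroup_PGL2 G -> finite_set G -> (orbit_poly G)`_n = p%:F / q%:F ->
  G s -> (ratfun_constP p).[s] / (ratfun_constP q).[s] = p%:F / q%:F.
Proof.
move=> G_sub G_fin coef_n Gs; have [_ _ G_comp _] := G_sub.
have [psi psiE psi_tofrac] :=
  ratfun_eval_rmorphism (subgroup_PGL2_transcendental G_sub Gs).
rewrite -!psi_tofrac -fmorph_div -coef_n -coef_map orbit_poly_fixed //.
by move=> t Gt; rewrite psiE; exact: G_comp.
Qed.

(** * Acting on coefficients *)

Section CoefficientAction.
Variable sigma : {rmorphism F -> F}.

Definition ratfun_map : {fraction {poly F}} -> {fraction {poly F}} :=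
  frac_lift (@FracField.tofrac _ \o map_poly sigma).

Let tofrac_map_inj : injective (@FracField.tofrac _ \o map_poly sigma).
Proof.
move=> p q /= /eqP; rewrite tofrac_eq => /eqP.
exact/map_poly_inj.
Qed.

HB.instance Definition _ := GRing.isZmodMorphism.Build _ _ ratfun_map
  (frac_lift_zmod_morphism tofrac_map_inj).
HB.instance Definition _ := GRing.isMonoidMorphism.Build _ _ ratfun_map
  (frac_lift_monoid_morphism tofrac_map_inj).

Lemma ratfun_map_tofrac p : ratfun_map p%:F = (map_poly sigma p)%:F.
Proof. exact: (frac_lift_tofrac tofrac_map_inj). Qed.

Lemma ratfun_map_const a : ratfun_map (ratfun_const a) = ratfun_const (sigma a).
Proof. by rewrite /ratfun_const ratfun_map_tofrac map_polyC. Qed.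

Lemma ratfun_map_lft A : ratfun_map (lft A) = lft (map_mx sigma A).
Proof.
rewrite /lft fmorph_div /= !ratfun_map_tofrac !mxE.
by rewrite !rmorphD /= !map_polyC !linearZ_LR /= !map_polyX.
Qed.

(** Two reduced forms of a fraction differ by a constant factor, which is 1 once
    the numerator or the denominator is monic on both sides. *)
Lemma reduced_fraction_fixed p q :
  coprimep p q -> p \is monic \/ q \is monic -> p != 0 -> q != 0 ->
  ratfun_map (p%:F / q%:F) = p%:F / q%:F ->
  map_poly sigma p = p /\ map_poly sigma q = q.
Proof.
move=> cop mon p0 q0; rewrite fmorph_div /= !ratfun_map_tofrac => /eqP.
rewrite eqr_div ?tofrac_eq0 ?map_poly_eq0 // -!tofracM tofrac_eq => /eqP eq_pq.
have eqp_p : map_poly sigma p %= p.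
  apply/andP; split.
    rewrite -(@Gauss_dvdpl _ _ (map_poly sigma q)) ?coprimep_map //.
    by rewrite -eq_pq dvdp_mulIl.
  by rewrite -(@Gauss_dvdpl _ _ q) // eq_pq dvdp_mulIl.
have eqp_q : map_poly sigma q %= q.
  by rewrite -(eqp_mul2l _ _ p0) -eq_pq eqp_mul2r.
case: mon => [p_mon|q_mon].
  have sp : map_poly sigma p = p.
    by apply/eqP; rewrite -eqp_monic ?monic_map.
  by split=> //; apply: (mulfI p0); rewrite -eq_pq sp.
have sq : map_poly sigma q = q.
  by apply/eqP; rewrite -eqp_monic ?monic_map.
by split=> //; apply: (mulIf q0); rewrite eq_pq sq.
Qed.

End CoefficientAction.
End RationalFunctionField.

Section FixedField.
Variables (F : fieldType) (H : set {rmorphism F -> F}).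

Lemma fixed_field0 : fixed_field H 0.
Proof. by move=> sigma _; rewrite rmorph0. Qed.

Lemma polyOver_fixed_field (p : {poly F}) :
  (forall sigma, H sigma -> map_poly sigma p = p) ->
  p \is a polyOver (mem (fixed_field H)).
Proof.
move=> p_fixed; apply/(polyOver_setP _ fixed_field0) => i sigma Hs.
by rewrite -coef_map p_fixed.
Qed.

(** In the reduced form of [s] with monic denominator, both terms are fixed. *)
Lemma fixed_ratfun_over s :
  (forall sigma, H sigma -> ratfun_map sigma s = s) ->
  ratfun_over (fixed_field H) s.
Proof.
move=> s_fixed; rewrite (fracE s).
set n := \n__; set d := \d__; have d0 : d != 0 by exact: denom_ratioP.
have [->|n0] := eqVneq n 0.
  exists 0, 1; rewrite tofrac0 !mul0r oner_eq0; split=> //.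
    by apply: polyOver_fixed_field => sigma _; rewrite map_poly0.
  by apply: polyOver_fixed_field => sigma _; rewrite rmorph1.
pose h := gcdp n d; have h0 : h != 0 by rewrite gcdp_eq0 (negPf d0) andbF.
have nE : n = n %/ h * h by rewrite divpK ?dvdp_gcdl.
have dE : d = d %/ h * h by rewrite divpK ?dvdp_gcdr.
have n'0 : n %/ h != 0 by apply: contraNneq n0 => n'0; rewrite nE n'0 mul0r.
have d'0 : d %/ h != 0 by apply: contraNneq d0 => d'0; rewrite dE d'0 mul0r.
pose u := (lead_coef (d %/ h))^-1.
have u0 : u != 0 by rewrite invr_eq0 lead_coef_eq0.
pose p := u *: (n %/ h); pose q := u *: (d %/ h).
have p0 : p != 0 by rewrite scaler_eq0 negb_or u0.
have q0 : q != 0 by rewrite scaler_eq0 negb_or u0.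
have q_mon : q \is monic by rewrite monicE lead_coefZ mulVf ?lead_coef_eq0.
have cop : coprimep p q.
  by rewrite coprimepZl ?coprimepZr // coprimep_div_gcd ?n0.
have pqE : n%:F / d%:F = p%:F / q%:F.
  apply/eqP; rewrite eqr_div ?tofrac_eq0 // -!tofracM tofrac_eq /p /q.
  by rewrite {1}nE {2}dE -scalerAr -scalerAl mulrAC mulrA.
have pq_fixed sigma : H sigma -> map_poly sigma p = p /\ map_poly sigma q = q.
  move/s_fixed; rewrite (fracE s) pqE.
  exact: (reduced_fraction_fixed cop (or_intror q_mon) p0 q0).
by exists p, q; split=> //; apply: polyOver_fixed_field => sigma /pq_fixed[].
Qed.

End FixedField.

(** * Matrices of linear fractional transformations *)

Lemma det_mx22 (R : comNzRingType) (A : 'M[R]_2) :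
  \det A = A 0 0 * A 1 1 - A 0 1 * A 1 0.
Proof.
rewrite (expand_det_row _ 0) !big_ord_recl big_ord0 addr0 /cofactor.
rewrite !det_mx11 !mxE expr0 expr1 mul1r mulN1r mulrN.
by congr (A _ _ * A _ _ - A _ _ * A _ _); apply: val_inj.
Qed.

Lemma ord2P (P : 'I_2 -> Prop) : P 0 -> P 1 -> forall i, P i.
Proof.
by move=> P0 P1 [[|[|//]] lt_i];
  [suff <- : 0 = Ordinal lt_i|suff <- : 1 = Ordinal lt_i] => //; apply: val_inj.
Qed.

(** Clearing denominators in [lft A = lft B] and comparing coefficients gives
    three bilinear equations in the entries, which force [\det A *: B] to be a
    multiple [u *: A]; the conclusion is the denominator-free form of the
    equality of the normalised entries of [A] and [B]. *)
Lemma lft_proportional (F : fieldType) (A B : 'M[F]_2) i j k l :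
  \det A != 0 -> \det B != 0 -> lft A = lft B ->
  A k l * B i j = B k l * A i j.
Proof.
rewrite !det_mx22 => A0 B0 /eqP.
have den0 (a b c d : F) : a * d - b * c != 0 -> c *: 'X + d%:P != 0.
  apply: contraNneq => cd0.
  have := congr1 (coefp 1) cd0; have := congr1 (coefp 0) cd0 => /=.
  rewrite !coefD !coefZ !coefX !coefC /= !mulr0 !add0r mulr1 addr0 => -> ->.
  by rewrite !mulr0 subrr.
rewrite eqr_div ?tofrac_eq0 ?(den0 _ _ _ _ A0) ?(den0 _ _ _ _ B0) //.
rewrite -!tofracM tofrac_eq => /eqP eqAB.
have coefE (a b : F) p m :
    ((a *: 'X + b%:P) * p)`_m = a * (if m == 0 then 0 else p`_m.-1) + b * p`_m.
  by rewrite mulrDl -scalerAl mul_polyC coefD !coefZ coefXM.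
have e0 : A 0 1 * B 1 1 = B 0 1 * A 1 1.
  have := congr1 (coefp 0) eqAB => /=.
  by rewrite !coefE /= !coefD !coefZ !coefX !coefC /= !mulr0 !add0r.
have e1 : A 0 0 * B 1 1 + A 0 1 * B 1 0 = B 0 0 * A 1 1 + B 0 1 * A 1 0.
  have := congr1 (coefp 1) eqAB => /=.
  rewrite !coefE /= !coefD !coefZ !coefX !coefC /=.
  by rewrite !mulr0 !add0r !mulr1 !addr0.
have e2 : A 0 0 * B 1 0 = B 0 0 * A 1 0.
  have := congr1 (coefp 2) eqAB => /=.
  rewrite !coefE /= !coefD !coefZ !coefX !coefC /=.
  by rewrite !mulr0 !addr0 !mulr1 !mulr0 !addr0.
pose dA := A 0 0 * A 1 1 - A 0 1 * A 1 0.
pose u := B 0 0 * A 1 1 - A 0 1 * B 1 0.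
have BE i' j' : dA * B i' j' = u * A i' j'.
  (* The coefficient of [x] gives the second expression of [u], needed for the
     entries of the second column. *)
  have uE : u = A 0 0 * B 1 1 - B 0 1 * A 1 0.
    by apply/eqP; rewrite /u subr_eq addrAC e1 addrK.
  move: i' j'; apply: ord2P; apply: ord2P; rewrite /dA.
  - by rewrite /u; ring: e2.
  - by rewrite uE; ring: e0.
  - by rewrite /u; ring: e2.
  - by rewrite uE; ring: e0.
apply: (mulfI A0); rewrite -/dA.
by rewrite mulrCA BE [RHS]mulrA BE mulrCA mulrA.
Qed.

(** * Equivariant interpolation *)

(** The entries of [r] are points [(abscissa, value)], and [Q] is Lagrange's
    interpolation polynomial.  Its formula is symmetric in the points and only
    uses field operations, so an endomorphism that permutes the points fixes
    its coefficients. *)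
Lemma equivariant_interpolation (M : fieldType) (r : seq (M * M)) :
  uniq r -> {in r &, forall u v, u.1 = v.1 -> u = v} ->
  exists2 Q : {poly M},
    {in r, forall u, Q.[u.1] = u.2} &
    forall psi : {rmorphism M -> M},
      {in r, forall u, (psi u.1, psi u.2) \in r} -> map_poly psi Q = Q.
Proof.
move=> r_uniq r_fun.
pose L (u v : M * M) : {poly M} := (u.1 - v.1)^-1 *: ('X - v.1%:P).
pose Q (s : seq (M * M)) : {poly M} :=
  \sum_(u <- s) u.2 *: \prod_(v <- s | v != u) L u v.
exists (Q r) => [u ru|psi r_stable].
  rewrite /Q horner_sum (bigD1_seq u) //=.
  rewrite [X in _ + X]big1_seq ?addr0 => [|w /andP[wu rw]]; last first.
    apply/eqP; rewrite hornerZ horner_prod mulf_eq0 prodf_seq_eq0.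
    apply/orP; right; apply/hasP; exists u => //.
    by rewrite eq_sym wu hornerZ hornerXsubC subrr mulr0 /=.
  rewrite hornerZ horner_prod big1_seq ?mulr1 // => v /andP[vu rv].
  rewrite hornerZ hornerXsubC mulVf // subr_eq0.
  by apply: contra_neq vu => /(r_fun _ _ ru rv).
pose psi2 (u : M * M) := (psi u.1, psi u.2).
have psi2_inj : injective psi2.
  by case=> [a b] [c d] [/fmorph_inj -> /fmorph_inj ->].
have perm_r : perm_eq (map psi2 r) r by exact: perm_map_stable.
transitivity (Q (map psi2 r)).
  rewrite /Q big_map rmorph_sum; apply: eq_bigr => u _ /=.
  rewrite big_map map_polyZ rmorph_prod; congr (_ *: _).
  apply: eq_big => [v|v _]; first by rewrite (inj_eq psi2_inj).
  by rewrite /L /= map_polyZ fmorphV rmorphB /= rmorphB /= map_polyX map_polyC.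
rewrite /Q (perm_big _ perm_r); apply: eq_bigr => u _.
by rewrite (perm_big _ perm_r).
Qed.

(** The points to interpolate are the orbit under [H] of
    [(lft A, A k l / A i j)]; they form the graph of a function because equal
    linear fractional transformations have proportional matrices. *)
Lemma normalized_entry_over_fixed_field (F : fieldType)
    (H : set {rmorphism F -> F}) (A : 'M[F]_2) i j k l :
  is_automorphism_group H -> finite_set H -> \det A != 0 -> A i j != 0 ->
  exists2 Q : {poly {fraction {poly F}}},
    (forall m, ratfun_over (fixed_field H) Q`_m) &
    Q.[lft A] = ratfun_const (A k l / A i j).
Proof.
move=> [H_id H_comp _] H_fin A0 Aij0.
pose pt (sigma : {rmorphism F -> F}) :=
  (lft (map_mx sigma A), ratfun_const (sigma (A k l / A i j))).
have /finite_seqP[r0 r0E] := finite_image pt H_fin.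
have r0P u : u \in r0 <-> exists2 sigma, H sigma & pt sigma = u.
  by have := congr1 (fun B => B u) r0E => /= <-.
have [|u v|Q Q_interp Q_equiv] := @equivariant_interpolation _ (undup r0).
- exact: undup_uniq.
- rewrite !mem_undup => /r0P[sigma _ <-] /r0P[tau _ <-] /= eq_lft.
  congr (_, _) => //; congr ratfun_const; rewrite !fmorph_div; apply/eqP.
  rewrite eqr_div ?fmorph_eq0 //; apply/eqP.
  have := lft_proportional i j k l _ _ eq_lft.
  by rewrite !det_map_mx !fmorph_eq0 !mxE; apply.
exists Q; last first.
  have := Q_interp (pt idfun); rewrite mem_undup /pt /= map_mx_id //; apply.
  by apply/r0P; exists idfun => //=; rewrite /pt map_mx_id.
move=> m; apply: fixed_ratfun_over => sigma Hs.
have QE : map_poly (ratfun_map sigma) Q = Q.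
  apply: Q_equiv => u; rewrite !mem_undup => /r0P[tau Ht <-]; apply/r0P.
  exists (sigma \o tau); first exact: H_comp.
  by rewrite /pt /= ratfun_map_lft ratfun_map_const map_mx_comp.
by rewrite -[in RHS]QE coef_map.
Qed.

(** * Roots of the generic fibre *)

Section GenericFiber.
Variables (F : fieldType) (LF : fieldExtType {fraction {poly F}}).
Variables (f g : {poly F}).

Definition const_ext : {rmorphism F -> LF} := in_alg LF \o @ratfun_const F.

Lemma horner_ratfun_constP_ext p s :
  in_alg LF (ratfun_constP p).[s] = (map_poly const_ext p).[in_alg LF s].
Proof. by rewrite /const_ext map_poly_comp horner_map. Qed.

Hypothesis fg_coprime : coprimep f g.

(** As [f] and [g] are coprime they have no common root, so the roots are
    exactly the solutions of [f(z)/g(z) = x]. *)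
Lemma root_generic_fiberP z :
  root (map_poly (in_alg LF) (generic_fiber f g)) z <->
  (map_poly const_ext g).[z] != 0 /\
  (map_poly const_ext f).[z] / (map_poly const_ext g).[z] = in_alg LF 'X%:F.
Proof.
have -> : map_poly (in_alg LF) (generic_fiber f g) =
    map_poly const_ext f - in_alg LF 'X%:F *: map_poly const_ext g.
  by rewrite rmorphB /= map_polyZ /= /ratfun_constP -!map_poly_comp.
rewrite /root hornerD hornerN hornerZ subr_eq0; split=> [/eqP fz|[gz0 <-]].
  suff gz0 : (map_poly const_ext g).[z] != 0.
    by split=> //; rewrite fz mulfK.
  apply/negP => /eqP gz0; have fz0 : root (map_poly const_ext f) z.
    by rewrite /root fz gz0 mulr0.
  have cop : coprimep (map_poly const_ext f) (map_poly const_ext g).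
    by rewrite coprimep_map.
  by have := coprimep_root cop fz0; rewrite gz0 eqxx.
by rewrite divfK.
Qed.

Lemma generic_fiber_root_transcendental z :
  root (map_poly (in_alg LF) (generic_fiber f g)) z ->
  ~ algebraicOver const_ext z.
Proof.
case/root_generic_fiberP => _ zX; apply: (@transcendental_ratio _ _ _ f g).
rewrite zX => -[p p0]; rewrite /root -horner_ratfun_constP_ext.
by rewrite ratfun_constP_X fmorph_eq0 tofrac_eq0 (negPf p0).
Qed.

(** Each coefficient of [f(T) - x g(T)] is a polynomial of degree at most 1 in
    [x], which vanishes only if the coefficients of [f] and [g] do. *)
Lemma size_generic_fiber :
  nonconstant (f%:F / g%:F) -> (1 < size (generic_fiber f g))%N.
Proof.
move=> fg_nonconst; rewrite ltnNge; apply/negP => size_le1; apply: fg_nonconst.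
have coef0 m : f`_m.+1 = 0 /\ g`_m.+1 = 0.
  have := nth_default 0 (leq_trans size_le1 (ltn0Sn m)).
  rewrite coefB coefZ /ratfun_constP !coef_map /ratfun_const -tofracM -tofracB.
  move/eqP; rewrite tofrac_eq0 => /eqP fg0.
  have g0 : g`_m.+1 = 0.
    have := congr1 (coefp 1) fg0.
    rewrite /= coefB coefXM !coefC /= sub0r => /eqP.
    by rewrite oppr_eq0 => /eqP.
  by move: fg0; rewrite g0 mulr0 subr0 => /eqP; rewrite polyC_eq0 => /eqP.
have const_of (h : {poly F}) : (forall m, h`_m.+1 = 0) -> h = (h`_0)%:P.
  by move=> h0; apply/polyP => -[|m]; rewrite coefC //= h0.
exists (f`_0 / g`_0); rewrite fmorph_div.
by congr (_%:F / _%:F); apply: const_of => m; case: (coef0 m).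
Qed.

End GenericFiber.

(** * The splitting field over the fixed field *)

Theorem lemma35 (F : fieldType) (G : set {fraction {poly F}})
    (G_subgroup : is_subgroup_PGL2 G) (G_finite : finite_set G)
    (G_field : forall K : set F,
      is_subfield K -> K <> setT -> ~ defined_over G K)
    (f g : {poly F}) (n : nat)
    (fg_coprime : coprimep f g)
    (fg_monic : f \is monic \/ g \is monic)
    (fg_coef : (orbit_poly G)`_n = f%:F / g%:F)
    (fg_nonconst : nonconstant (f%:F / g%:F))
    (LF : fieldExtType {fraction {poly F}})
    (LF_splitting : splittingFieldFor 1%VS
      (map_poly (in_alg LF) (generic_fiber f g)) fullv)
    (H : set {rmorphism F -> F})
    (H_group : is_automorphism_group H) (H_finite : finite_set H)
    (H_nontrivial : exists2 sigma, H sigma & ~ (sigma =1 id))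
    (H_fixes_G : forall sigma, H sigma -> aut_act sigma G = G) :
  let E := fixed_field H in
  let LE := splitting_subfield (in_alg LF @` ratfun_over E)
              (map_poly (in_alg LF) (generic_fiber f g)) in
  [/\ f \is a polyOver (mem E), g \is a polyOver (mem E),
      range (in_alg LF) `<=` LE & LE = setT].
Proof.
move=> E LE; pose iota := const_ext LF; pose X := in_alg LF 'X%:F.
pose P := map_poly (in_alg LF) (generic_fiber f g).
have f0 : f != 0.
  apply/eqP => f0; apply: fg_nonconst; exists 0.
  by rewrite f0 tofrac0 mul0r rmorph0.
have g0 : g != 0.
  apply/eqP => g0; apply: fg_nonconst; exists 0.
  by rewrite g0 tofrac0 invr0 mulr0 rmorph0.
have fg_fixed sigma : H sigma -> map_poly sigma f = f /\ map_poly sigma g = g.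
  move=> Hs; apply: reduced_fraction_fixed => //.
  rewrite -fg_coef -coef_map /= orbit_poly_fixed // => s Gs.
  have [PGL_G _ _ _] := G_subgroup; have [A /= A0 sE] := PGL_G _ Gs.
  by rewrite -(H_fixes_G _ Hs) -sE ratfun_map_lft; exists A => //=; rewrite sE.
have LE_sub : is_subfield LE by exact: subfield_genP.
have LE_base s : ratfun_over E s -> LE (in_alg LF s).
  by move=> Es S [_ base_S]; apply: base_S; left; exists s.
have LE_root z : root P z -> LE z.
  by move=> Pz S [_ base_S]; apply: base_S; right.
have E_poly p : (forall sigma, H sigma -> map_poly sigma p = p) ->
    p \is a polyOver (mem E) by exact: polyOver_fixed_field.
have E1 : (1 : {poly F}) \is a polyOver (mem E).
  by apply: E_poly => sigma _; rewrite rmorph1.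
have LE_E a : E a -> LE (iota a).
  move=> Ea; apply: LE_base; exists a%:P, 1.
  split; rewrite ?oner_eq0 ?tofrac1 ?divr1 //.
  by apply: E_poly => sigma Hs; rewrite map_polyC /= Ea.
have LE_X : LE X.
  apply: LE_base; exists 'X, 1; split; rewrite ?oner_eq0 ?tofrac1 ?divr1 //.
  by apply: E_poly => sigma Hs; rewrite map_polyX.
have [rs P_rs LF_rs] := LF_splitting.
have rsP z : (z \in rs) = root P z by rewrite (eqp_root P_rs) root_prod_XsubC.
have [y Py] : exists y, root P y.
  have : (1 < size P)%N by rewrite size_map_poly size_generic_fiber.
  rewrite (eqp_size P_rs) size_prod_XsubC ltnS.
  case: rs rsP {P_rs LF_rs} => // y rs rsP _.
  by exists y; rewrite -rsP mem_head.
(* [psi] is the substitution of [y] for [x]. *)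
have [psi _ psi_tofrac] :=
  ratfun_eval_rmorphism (generic_fiber_root_transcendental fg_coprime Py).
have psi_const a : psi (ratfun_const a) = iota a.
  by rewrite psi_tofrac map_polyC hornerC.
have psi_horner p s : psi (ratfun_constP p).[s] = (map_poly iota p).[psi s].
  rewrite -horner_map /ratfun_constP -map_poly_comp /=.
  by congr (_.[_]); apply: eq_map_poly => a /=; exact: psi_const.
have psi_fg : psi (f%:F / g%:F) = X.
  rewrite fmorph_div /= !psi_tofrac.
  by case/(root_generic_fiberP fg_coprime _): Py.
have LE_psi s : ratfun_over E s -> LE (psi s).
  case=> p [q [Ep Eq _ ->]]; rewrite fmorph_div /= !psi_tofrac.
  have E0 : E 0 by exact: fixed_field0.
  have LE_horner r : r \is a polyOver (mem E) -> LE (map_poly iota r).[y].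
    move=> /(polyOver_setP _ E0) Er.
    apply: (subfield_horner LE_sub); last exact: LE_root.
    by move=> i; rewrite coef_map; apply: LE_E; apply: Er.
  by apply: (subfield_div LE_sub); exact: LE_horner.
have LE_conj s : G s -> LE (psi s).
  move=> Gs; apply: LE_root; apply/(root_generic_fiberP fg_coprime _).
  rewrite -!psi_horner -fmorph_div /=.
  rewrite (orbit_coef_invariant G_subgroup G_finite fg_coef Gs).
  split=> //; rewrite fmorph_eq0; apply/negP => gs0.
  by apply: (subgroup_PGL2_transcendental G_subgroup Gs); exists g.
have LE_const a : LE (iota a).
  (* [G] is defined over [K], the field of constants of [LE]. *)
  pose K := iota @^-1` LE.
  have K_sub : is_subfield K by exact: subfield_preim.
  suff KT : K = setT by have : K a by rewrite KT.
  apply: contrapT => /(G_field _ K_sub); apply=> A A0 GA.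
  have [i [j Aij0]] : exists i j, A i j != 0.
    apply: contrapT => noA; move/eqP: A0; apply.
    suff -> : A = 0 by rewrite det0.
    apply/matrixP => i j; rewrite mxE; apply/eqP/negPn/negP => Aij0.
    by apply: noA; exists i, j.
  exists i, j; split=> // k l; suff: LE (iota (A k l / A i j)) by [].
  have [Q E_Q QA] :=
    normalized_entry_over_fixed_field k l H_group H_finite A0 Aij0.
  rewrite -psi_const -QA -horner_map; apply: (subfield_horner LE_sub) => //.
    by move=> m; rewrite coef_map; apply: LE_psi; apply: E_Q.
  exact: LE_conj.
have LE_F : range (in_alg LF) `<=` LE.
  move=> _ [s _ <-]; rewrite (fracE s) fmorph_div /=.
  have LE_poly p : LE (in_alg LF p%:F).
    rewrite -ratfun_constP_X horner_ratfun_constP_ext.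
    apply: (subfield_horner LE_sub) => // m.
    by rewrite coef_map; apply: LE_const.
  by apply: (subfield_div LE_sub); exact: LE_poly.
split=> //.
- by apply: E_poly => sigma /fg_fixed[].
- by apply: E_poly => sigma /fg_fixed[].
apply/seteqP; split=> // z _; apply: (subfield_adjoin LE_sub LE_F (rs := rs)).
  by move=> w /= ; rewrite rsP; exact: LE_root.
by rewrite LF_rs memvf.
Qed.
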